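(* Let $\varepsilon=0$ and let $\{U^n\}_{n=0}^N$ be a solution of the CNFD scheme. Then the discrete mass and the discrete energy are conserved: for all $n=0,\dots,N-1$, $$\|U^{n+1}\|_{2,h}^2=\|U^n\|_{2,h}^2\qquad\text{and}\qquad E_h(U^{n+1})=E_h(U^n).$$
   Context: Constants: $\lambda\in\mathbb{R}$, $\nu>0$, $\varepsilon\ge0$, $T>0$; $\Omega=(a,b)\times(c,d)\subset\mathbb{R}^2$; $u_0:\overline\Omega\to\mathbb{C}$, vanishing on $\partial\Omega$. Grid: $x_j=a+j\Delta x$, $\Delta x=(b-a)/J$, $y_k=c+k\Delta y$, $\Delta y=(d-c)/K$, for $0\le j\le J$, $0\le k\le K$, with $\Delta x=\Delta y=h$. Time grid: $t_n=n\tau$, $n=0,\dots,N$, $N\tau=T$. $\mathcal{T}_{JK}=\{(j,k):1\le j\le J-1,\ 1\le k\le K-1\}$. $X_{JK}$ is the space of complex grid functions $u=(u_{j,k})_{0\le j\le J,\,0\le k\le K}$ with $u_{0,k}=u_{J,k}=u_{j,0}=u_{j,K}=0$ for all $j,k$. Difference operators: $\delta_t^+u^n_{j,k}=(u^{n+1}_{j,k}-u^n_{j,k})/\tau$, $\delta_x^+u_{j,k}=(u_{j+1,k}-u_{j,k})/\Delta x$, $\delta_y^+u_{j,k}=(u_{j,k+1}-u_{j,k})/\Delta y$, $\delta^2u_{j,k}=\frac{u_{j+1,k}-2u_{j,k}+u_{j-1,k}}{(\Delta x)^2}+\frac{u_{j,k+1}-2u_{j,k}+u_{j,k-1}}{(\Delta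 y)^2}$. Norms: $\|u\|_{p,h}^p=\Delta x\Delta y\sum_{j=0}^{J-1}\sum_{k=0}^{K-1}|u_{j,k}|^p$, $\|\delta^+u\|_{2,h}^2=\|\delta_x^+u\|_{2,h}^2+\|\delta_y^+u\|_{2,h}^2$. The discrete mass of $U$ is $\|U\|_{2,h}^2$. Discrete energy: $E_h(U)=\|\delta^+U\|_{2,h}^2-\frac{\lambda}{2}\|U\|_{4,h}^4+\frac{\nu}{3}\|U\|_{6,h}^6$. For $z,w\in\mathbb{C}$: $\psi_1(z,w)=\frac{|z|^2+|w|^2}{2}\cdot\frac{z+w}{2}$, $\psi_2(z,w)=\frac{|z|^4+|z|^2|w|^2+|w|^4}{3}\cdot\frac{z+w}{2}$, $\varphi(z,w)=\left|\frac{z+w}{2}\right|^2\frac{z+w}{2}$. CNFD scheme: $\{U^n\}_{n=0}^N$ is a solution if $U^0_{j,k}=u_0(x_j,y_k)$, $U^{n+1}\in X_{JK}$ for $n=0,\dots,N-1$, and, with $U^{n+1/2}=\frac12(U^{n+1}+U^n)$, for all $(j,k)\in\mathcal{T}_{JK}$ and $n=0,\dots,N-1$, $$i\delta_t^+U^n_{j,k}+\delta^2U^{n+1/2}_{j,k}+\lambda\psi_1(U^{n+1}_{j,k},U^n_{j,k})-\nu\psi_2(U^{n+1}_{j,k},U^n_{j,k})+i\varepsilon\varphi(U^{n+1}_{j,k},U^n_{j,k})=0.$$ *)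

(* Defs.v *)
From mathcomp Require Import all_boot all_order all_algebra.
From mathcomp Require Import all_classical all_reals.
From mathcomp Require Import topology normedtype.
From mathcomp Require Import complex.

Set Implicit Arguments.
Unset Strict Implicit.
Unset Printing Implicit Defensive.

Import Order.TTheory GRing.Theory Num.Theory.
Import numFieldNormedType.Exports.

Local Open Scope ring_scope.
Local Open Scope classical_set_scope.
Local Open Scope complex_scope.

Definition rectangle (R : realType) (a b c d : R) : set (R * R) :=
  `]a, b[ `*` `]c, d[.

Definition boundary (T : topologicalType) (A : set T) : set T :=
  closure A `\` interior A.

Definition step (R : realType) (a b : R) (J : nat) : R := (b - a) / J%:R.

Definition node (R : realType) (a b : R) (J : nat) (j : nat) : R :=
  a + j%:R * step a b J.

(* A grid function is indexed by nat * nat; only its values at indices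
   0 <= j <= J, 0 <= k <= K are ever constrained or used. *)
Definition gridfun (R : realType) : Type := nat -> nat -> R[i].

Definition inX (R : realType) (J K : nat) (u : gridfun R) : Prop :=
  (forall k, (k <= K)%N -> u 0%N k = 0 /\ u J k = 0) /\
  (forall j, (j <= J)%N -> u j 0%N = 0 /\ u j K = 0).

Definition inT (J K j k : nat) : bool :=
  (1 <= j <= J.-1)%N && (1 <= k <= K.-1)%N.

Definition delta_t (R : realType) (tau : R) (U : nat -> gridfun R) (n : nat) :
    gridfun R :=
  fun j k => (U n.+1 j k - U n j k) / tau%:C.

Definition delta_x (R : realType) (dx : R) (u : gridfun R) : gridfun R :=
  fun j k => (u j.+1 k - u j k) / dx%:C.

Definition delta_y (R : realType) (dy : R) (u : gridfun R) : gridfun R :=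
  fun j k => (u j k.+1 - u j k) / dy%:C.

(* The predecessors are truncated at 0, but the operator is only applied at
   interior indices j, k >= 1. *)
Definition delta2 (R : realType) (dx dy : R) (u : gridfun R) : gridfun R :=
  fun j k =>
    (u j.+1 k - 2 * u j k + u j.-1 k) / dx%:C ^+ 2 +
    (u j k.+1 - 2 * u j k + u j k.-1) / dy%:C ^+ 2.

(* normhX J K dx dy p u is the p-th power of the discrete L^p norm of u.
   normc is the R-valued modulus: `|z| = (normc z)%:C in R[i]. *)
Definition normhX (R : realType) (J K : nat) (dx dy : R) (p : nat)
    (u : gridfun R) : R :=
  dx * dy *
  \sum_(0 <= j < J) \sum_(0 <= k < K) (ComplexField.Normc.normc (u j k) : R) ^+ p.

Definition gradhX2 (R : realType) (J K : nat) (dx dy : R) (u : gridfun R) : R :=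
  normhX J K dx dy 2 (delta_x dx u) + normhX J K dx dy 2 (delta_y dy u).

Definition mass (R : realType) (J K : nat) (dx dy : R) (u : gridfun R) : R :=
  normhX J K dx dy 2 u.

Definition energy (R : realType) (lambda nu : R) (J K : nat) (dx dy : R)
    (u : gridfun R) : R :=
  gradhX2 J K dx dy u - lambda / 2 * normhX J K dx dy 4 u
  + nu / 3 * normhX J K dx dy 6 u.

Definition psi1 (R : realType) (z w : R[i]) : R[i] :=
  (`|z| ^+ 2 + `|w| ^+ 2) / 2 * ((z + w) / 2).

Definition psi2 (R : realType) (z w : R[i]) : R[i] :=
  (`|z| ^+ 4 + `|z| ^+ 2 * `|w| ^+ 2 + `|w| ^+ 4) / 3 * ((z + w) / 2).

Definition phi (R : realType) (z w : R[i]) : R[i] :=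
  `|(z + w) / 2| ^+ 2 * ((z + w) / 2).

Definition halfstep (R : realType) (U : nat -> gridfun R) (n : nat) :
    gridfun R :=
  fun j k => (U n.+1 j k + U n j k) / 2.

Definition CNFD_solution (R : realType) (lambda nu eps a b c d : R)
    (J K N : nat) (tau : R) (u0 : R * R -> R[i]) (U : nat -> gridfun R) :
    Prop :=
  let dx := step a b J in
  let dy := step c d K in
  [/\ forall j k, (j <= J)%N -> (k <= K)%N ->
        U 0%N j k = u0 (node a b J j, node c d K k),
      forall n, (n < N)%N -> inX J K (U n.+1) &
      forall n, (n < N)%N -> forall j k, inT J K j k ->
        'i%C * delta_t tau U n j k
        + delta2 dx dy (halfstep U n) j k
        + lambda%:C * psi1 (U n.+1 j k) (U n j k)
        - nu%:C * psi2 (U n.+1 j k) (U n j k)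
        + 'i%C * eps%:C * phi (U n.+1 j k) (U n j k) = 0].

(* Main.v *)
Require Import Defs.
From mathcomp Require Import all_boot all_order all_algebra.
From mathcomp Require Import all_classical all_reals.
From mathcomp Require Import topology normedtype.
From mathcomp Require Import complex.
From mathcomp Require Import ring.

Set Implicit Arguments.
Unset Strict Implicit.
Unset Printing Implicit Defensive.

Import Order.TTheory GRing.Theory Num.Theory.
Import numFieldNormedType.Exports.
Local Open Scope ring_scope.
Local Open Scope classical_set_scope.
Local Open Scope complex_scope.

(** Let Z and W be two consecutive levels, D = (W - Z) / tau, H = (W + Z) / 2,
    and let z^* be the complex conjugate.  Both conservation laws come from
    testing the scheme against a grid function v that vanishes on the border of
    the grid and combining the result with its complex conjugate.

    The Laplacian is treated by summation by parts, in the form [gsum_green]: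
    the density (delta2 u) v + (delta_x u) (delta_x v) + (delta_y u) (delta_y v)
    sums to zero over the grid as soon as v vanishes on the border.  This form
    is bilinear, not sesquilinear, so it applies as it stands to a function and
    to its conjugate.

    For the mass, the test function is (W + Z)^*.  Subtracting the conjugate
    identity kills the nonlinear terms, which are real multiples of |W + Z|^2,
    and turns the time difference into a multiple of |W|^2 - |Z|^2; the rest is
    a difference of two Green densities ([mass_cell]).

    For the energy, the test function is (W - Z)^*.  Adding the conjugate
    identity kills the time difference, which is i |W - Z|^2 / tau, while psi1
    and psi2 become the exact differences (|W|^4 - |Z|^4) / 2 and
    (|W|^6 - |Z|^6) / 3: they are divided differences made for this purpose.
    The cross terms of the discrete gradients polarize to differences of squares,
    so in each cell the jump of the energy density is a sum of two Green
    densities ([energy_cell]).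

    The scheme imposes zero border values at the levels n >= 1 only.  At level 0
    they come from the initial datum: the border nodes lie on the topological
    boundary of the rectangle, where u0 vanishes ([inX_sample]). *)

(** * Border values of the initial level *)

Lemma itv_cc_closure_oo (R : realType) (a b x : R) :
  a < b -> a <= x <= b -> closure `]a, b[ x.
Proof.
move=> ltab /andP[ax xb] P Px.
have [ltxb | lebx] := ltP x b.
  have PN : \forall y \near x^'+, (`]a, b[ `&` P) y.
    near=> y; split.
      rewrite /= in_itv /=; apply/andP; split.
        by apply: (le_lt_trans ax); near: y; exact: nbhs_right_gt.
      by near: y; exact: nbhs_right_lt.
    by near: y; exact: cvg_within.
  exact: (filter_ex PN).
have PN : \forall y \near x^'-, (`]a, b[ `&` P) y.
  near=> y; split.
    rewrite /= in_itv /=; apply/andP; split.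
      by near: y; apply: nbhs_left_gt; apply: (lt_le_trans ltab).
    by apply: lt_le_trans xb; near: y; exact: nbhs_left_lt.
  by near: y; exact: cvg_within.
exact: (filter_ex PN).
Unshelve. all: by end_near. Qed.

Lemma boundary_rectangle (R : realType) (a b c d : R) (p : R * R) :
  a < b -> c < d -> a <= p.1 <= b -> c <= p.2 <= d ->
  ~ rectangle a b c d p -> boundary (rectangle a b c d) p.
Proof.
move=> ltab ltcd p1 p2 notin; split; last by move/interior_subset.
move=> B [[P Q] /= [P1 Q2] PQB].
have [x [xab Px]] := itv_cc_closure_oo ltab p1 P1.
have [y [ycd Qy]] := itv_cc_closure_oo ltcd p2 Q2.
by exists (x, y); split; [split | exact: PQB].
Qed.

Lemma node0 (R : realType) (a b : R) (J : nat) : node a b J 0 = a.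
Proof. by rewrite /node mul0r addr0. Qed.

Lemma node_last (R : realType) (a b : R) (J : nat) :
  (0 < J)%N -> node a b J J = b.
Proof.
move=> J0; rewrite /node /step mulrC divfK ?pnatr_eq0 -?lt0n //.
by rewrite addrC subrK.
Qed.

Lemma node_itv (R : realType) (a b : R) (J j : nat) :
  a < b -> (0 < J)%N -> (j <= J)%N -> a <= node a b J j <= b.
Proof.
move=> ltab J0 jJ.
have s0 : 0 <= step a b J.
  by rewrite /step divr_ge0 ?ler0n // subr_ge0 ltW.
apply/andP; split; first by rewrite lerDl mulr_ge0.
rewrite -[leRHS](node_last a b J0) lerD2l.
by rewrite ler_wpM2r // ler_nat.
Qed.

(** A border node has a coordinate equal to an endpoint of its side, so it lies
    in the closed rectangle but not in the open one. *)
Lemma inX_sample (R : realType) (a b c d : R) (J K : nat) (u0 : R * R -> R[i])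
    (u : gridfun R) :
  a < b -> c < d -> (0 < J)%N -> (0 < K)%N ->
  (forall z, boundary (rectangle a b c d) z -> u0 z = 0) ->
  (forall j k, (j <= J)%N -> (k <= K)%N ->
     u j k = u0 (node a b J j, node c d K k)) ->
  inX J K u.
Proof.
move=> ltab ltcd J0 K0 u0B uE.
have zero j k : (j <= J)%N -> (k <= K)%N ->
    ~ rectangle a b c d (node a b J j, node c d K k) -> u j k = 0.
  move=> jJ kK nin; rewrite uE //; apply: u0B.
  by apply: boundary_rectangle => //; exact: node_itv.
split=> [k kK | j jJ]; split; apply: zero => //;
  rewrite ?node0 ?node_last //; case=> /=; rewrite !in_itv /= ?ltxx ?andbF //.
Qed.

(** * Summation by parts *)

Definition conjg (R : realType) (u : gridfun R) : gridfun R :=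
  fun j k => (u j k)^*%C.

Definition gsum (R : realType) (J K : nat) (u : gridfun R) : R[i] :=
  \sum_(0 <= j < J) \sum_(0 <= k < K) u j k.

(** The discrete analogue of v Laplacian(u) + grad u . grad v = div (v grad u). *)
Definition green_density (R : realType) (dx dy : R) (u v : gridfun R) :
    gridfun R :=
  fun j k => delta2 dx dy u j k * v j k
             + delta_x dx u j k * delta_x dx v j k
             + delta_y dy u j k * delta_y dy v j k.

(** The j-th term is the increment of j |-> (u j - u j.-1) * v j.  The truncated
    predecessor makes this flux vanish at j = 0, whatever v 0 is. *)
Lemma sum_by_parts (F : comPzRingType) (J : nat) (u v : nat -> F) :
  v J = 0 ->
  \sum_(0 <= j < J) ((u j.+1 - 2 * u j + u j.-1) * v j
                     + (u j.+1 - u j) * (v j.+1 - v j)) = 0.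
Proof.
move=> vJ.
rewrite (@telescope_sumr_eq _ 0 J (fun j => (u j - u j.-1) * v j)) //.
  by rewrite vJ subrr mulr0 mul0r subrr.
by move=> j _ /=; ring.
Qed.

Section Gsum.
Variables (R : realType) (J K : nat).
Implicit Types u v : gridfun R.

Lemma eq_gsum u v :
  (forall j k, (j < J)%N -> (k < K)%N -> u j k = v j k) ->
  gsum J K u = gsum J K v.
Proof.
move=> uv; apply: eq_big_nat => j /andP[_ jJ].
by apply: eq_big_nat => k /andP[_ kK]; exact: uv.
Qed.

Lemma gsumD u v : gsum J K (fun j k => u j k + v j k) = gsum J K u + gsum J K v.
Proof. by rewrite -big_split; apply: eq_bigr => j _; rewrite -big_split. Qed.

Lemma gsumZ x u : gsum J K (fun j k => x * u j k) = x * gsum J K u.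
Proof. by rewrite mulr_sumr; apply: eq_bigr => j _; rewrite mulr_sumr. Qed.

Lemma gsumB u v : gsum J K (fun j k => u j k - v j k) = gsum J K u - gsum J K v.
Proof.
rewrite -[in RHS]mulN1r -gsumZ -gsumD.
by apply: eq_gsum => j k _ _; rewrite mulN1r.
Qed.

Lemma gsum_green (dx dy : R) u v :
  inX J K v -> gsum J K (green_density dx dy u v) = 0.
Proof.
move=> [vJ vK].
pose X : gridfun R := fun j k =>
  (u j.+1 k - 2 * u j k + u j.-1 k) * v j k
  + (u j.+1 k - u j k) * (v j.+1 k - v j k).
pose Y : gridfun R := fun j k =>
  (u j k.+1 - 2 * u j k + u j k.-1) * v j k
  + (u j k.+1 - u j k) * (v j k.+1 - v j k).
have X0 : gsum J K X = 0.
  rewrite /gsum exchange_big_nat big_nat big1 // => k /andP[_ kK].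
  apply: (@sum_by_parts _ J (u^~ k) (v^~ k)).
  by case: (vJ k (ltnW kK)).
have Y0 : gsum J K Y = 0.
  rewrite /gsum big_nat big1 // => j /andP[_ jJ].
  by apply: (@sum_by_parts _ K (u j) (v j)); case: (vK j (ltnW jJ)).
transitivity (gsum J K (fun j k =>
    (dx%:C^-1) ^+ 2 * X j k + (dy%:C^-1) ^+ 2 * Y j k)).
  apply: eq_gsum => j k _ _.
  rewrite /green_density /delta2 /delta_x /delta_y /X /Y -!exprVn.
  by ring.
by rewrite gsumD !gsumZ X0 Y0 !mulr0 addr0.
Qed.

Lemma inX_conjg u : inX J K u -> inX J K (conjg u).
Proof.
move=> [uJ uK]; split=> [k /uJ | j /uK] [e0 e1];
  by rewrite /conjg e0 e1 rmorph0.
Qed.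

Lemma inXD u v : inX J K u -> inX J K v -> inX J K (fun j k => u j k + v j k).
Proof.
move=> [uJ uK] [vJ vK]; split=> [k kK | j jJ].
  by have [-> ->] := uJ k kK; have [-> ->] := vJ k kK; rewrite addr0.
by have [-> ->] := uK j jJ; have [-> ->] := vK j jJ; rewrite addr0.
Qed.

Lemma inXB u v : inX J K u -> inX J K v -> inX J K (fun j k => u j k - v j k).
Proof.
move=> [uJ uK] [vJ vK]; split=> [k kK | j jJ].
  by have [-> ->] := uJ k kK; have [-> ->] := vJ k kK; rewrite subr0.
by have [-> ->] := uK j jJ; have [-> ->] := vK j jJ; rewrite subr0.
Qed.

(** The sums run over 0 <= j < J and 0 <= k < K, which contains the border nodes
    with j = 0 or k = 0 besides the interior ones. *)
Lemma inX_out u j k : inX J K u -> (j < J)%N -> (k < K)%N -> ~~ inT J K j k ->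
  u j k = 0.
Proof.
move=> [uJ uK] jJ kK; rewrite /inT.
case: j jJ => [|j] jJ; first by case: (uJ k (ltnW kK)).
case: k kK => [|k] kK; first by case: (uK j.+1 (ltnW jJ)).
by case: J K jJ kK => [|J'] [|K'] //=; rewrite !ltnS => -> ->.
Qed.

(** The norms and the energy are compared inside R[i], where their densities can
    be combined with products of a function and its conjugate. *)
Lemma normhXC dx dy p u :
  (normhX J K dx dy p u)%:C =
  dx%:C * dy%:C * gsum J K (fun j k => `|u j k| ^+ p).
Proof.
rewrite /normhX !rmorphM rmorph_sum; congr (_ * _); apply: eq_bigr => j _.
by rewrite rmorph_sum; apply: eq_bigr => k _; rewrite rmorphXn.
Qed.

Lemma energyC lambda nu dx dy u :
  (energy lambda nu J K dx dy u)%:C =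
  dx%:C * dy%:C * gsum J K (fun j k =>
     `|delta_x dx u j k| ^+ 2 + `|delta_y dy u j k| ^+ 2
     + (- (lambda%:C / 2) * `|u j k| ^+ 4 + nu%:C / 3 * `|u j k| ^+ 6)).
Proof.
have realC (l n A1 A2 B C : R) : (A1 + A2 - l / 2 * B + n / 3 * C)%:C =
    A1%:C + A2%:C - l%:C / 2 * B%:C + n%:C / 3 * C%:C.
  by rewrite !(rmorph_nat, fmorphV, rmorphM, rmorphN, rmorphD).
rewrite /energy /gradhX2 realC !normhXC 3!gsumD !gsumZ.
by ring.
Qed.

End Gsum.

(** * Complex conjugation and the nonlinear terms *)

Section Conj.
Variable R : realType.
Implicit Types x y z : R[i].

Let conjcD x y : (x + y)^*%C = x^*%C + y^*%C. Proof. exact: rmorphD. Qed.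
Let conjcN x : (- x)^*%C = - x^*%C. Proof. exact: rmorphN. Qed.
Let conjcM x y : (x * y)^*%C = x^*%C * y^*%C. Proof. exact: rmorphM. Qed.
Let conjcV x : (x^-1)^*%C = (x^*%C)^-1. Proof. exact: fmorphV. Qed.
Let conjcX x n : (x ^+ n)^*%C = x^*%C ^+ n. Proof. exact: rmorphXn. Qed.
Let conjc2 : (2 : R[i])^*%C = 2. Proof. exact: rmorph_nat. Qed.
Let conjc3 : (3 : R[i])^*%C = 3. Proof. exact: rmorph_nat. Qed.
Let conjcI : ('i%C : R[i])^*%C = - 'i%C.
Proof. by apply/eqP; rewrite eq_complex /= oppr0 !eqxx. Qed.
Let conjc_norm z : (`|z|)^*%C = `|z|. Proof. by rewrite normc_def conjc_real. Qed.

(* The rule for powers comes before the one for products, which would unfold a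
   power into a product. *)
Definition conjcE := (conjc2, conjc3, conjcI, conjc_norm, @conjc_real R,
  conjcX, conjcV, conjcD, conjcN, conjcM).

Lemma conjc_delta2 (dx dy : R) (u : gridfun R) j k :
  (delta2 dx dy u j k)^*%C = delta2 dx dy (conjg u) j k.
Proof. by rewrite /delta2 /conjg !conjcE. Qed.

Lemma conjc_psi z w :
  (psi1 z w)^*%C = psi1 (z^*%C) (w^*%C) /\ (psi2 z w)^*%C = psi2 (z^*%C) (w^*%C).
Proof. by rewrite /psi1 /psi2 !normcJ !conjcE. Qed.

End Conj.

Section Nonlinearity.
Variable R : realType.
Implicit Types z w : R[i].

(** psi1 z w and psi2 z w are real multiples of z + w, so that their products
    with the conjugate of z + w are real. *)
Lemma psi1_mass z w : psi1 z w * (z + w)^*%C = psi1 z^*%C w^*%C * (z + w).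
Proof. by rewrite /psi1 !normcJ !conjcE; ring. Qed.

Lemma psi2_mass z w : psi2 z w * (z + w)^*%C = psi2 z^*%C w^*%C * (z + w).
Proof. by rewrite /psi2 !normcJ !conjcE; ring. Qed.

Lemma polarize z w :
  (z + w) * (z - w)^*%C + (z + w)^*%C * (z - w) = 2 * (`|z| ^+ 2 - `|w| ^+ 2).
Proof. by rewrite !sqr_normc !conjcE; ring. Qed.

(** The real factor of psi1 z w is (|z|^4 - |w|^4) / (|z|^2 - |w|^2) up to a
    constant, and the denominator is what [polarize] produces. *)
Lemma psi1_energy z w :
  psi1 z w * (z - w)^*%C + psi1 z^*%C w^*%C * (z - w)
  = (`|z| ^+ 4 - `|w| ^+ 4) / 2.
Proof.
rewrite /psi1 !normcJ.
move: (polarize z w); rewrite !conjcE.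
move: (`|z|) (`|w|) (z^*%C) (w^*%C) => nz nw z' w' E.
transitivity ((nz ^+ 2 + nw ^+ 2) / 4
              * ((z + w) * (z' - w') + (z' + w') * (z - w))).
  by field.
by rewrite E; field.
Qed.

(** The real factor of psi2 z w is (|z|^6 - |w|^6) / (|z|^2 - |w|^2) up to a
    constant. *)
Lemma psi2_energy z w :
  psi2 z w * (z - w)^*%C + psi2 z^*%C w^*%C * (z - w)
  = (`|z| ^+ 6 - `|w| ^+ 6) / 3.
Proof.
rewrite /psi2 !normcJ.
move: (polarize z w); rewrite !conjcE.
move: (`|z|) (`|w|) (z^*%C) (w^*%C) => nz nw z' w' E.
transitivity ((nz ^+ 4 + nz ^+ 2 * nw ^+ 2 + nw ^+ 4) / 6
              * ((z + w) * (z' - w') + (z' + w') * (z - w))).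
  by field.
by rewrite E; field.
Qed.

End Nonlinearity.

(** * One step of the scheme *)

Section OneStep.
Variables (R : realType) (lambda nu dx dy tau : R) (J K : nat).
Variables Z W : gridfun R.
Hypotheses (ZX : inX J K Z) (WX : inX J K W) (tau0 : tau != 0).
Let H : gridfun R := fun j k => (W j k + Z j k) / 2.
Let D : gridfun R := fun j k => (W j k - Z j k) / tau%:C.
Let S : gridfun R := fun j k => W j k + Z j k.
Let V : gridfun R := fun j k => W j k - Z j k.
Hypothesis scheme : forall j k, inT J K j k ->
  'i%C * D j k + delta2 dx dy H j k + lambda%:C * psi1 (W j k) (Z j k)
  - nu%:C * psi2 (W j k) (Z j k) = 0.

Let SX : inX J K S. Proof. exact: inXD. Qed.
Let VX : inX J K V. Proof. exact: inXB. Qed.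

Lemma tested_scheme v : inX J K v -> forall j k, (j < J)%N -> (k < K)%N ->
  ('i%C * D j k + delta2 dx dy H j k + lambda%:C * psi1 (W j k) (Z j k)
   - nu%:C * psi2 (W j k) (Z j k)) * v j k = 0.
Proof.
move=> vX j k jJ kK; have [/scheme -> | out] := boolP (inT J K j k).
  by rewrite mul0r.
by rewrite (inX_out vX) // mulr0.
Qed.

Lemma tested_scheme_conj v : inX J K v -> forall j k, (j < J)%N -> (k < K)%N ->
  (- 'i%C * conjg D j k + delta2 dx dy (conjg H) j k
   + lambda%:C * psi1 (conjg W j k) (conjg Z j k)
   - nu%:C * psi2 (conjg W j k) (conjg Z j k)) * v j k = 0.
Proof.
move=> vX j k jJ kK; have := tested_scheme (inX_conjg vX) jJ kK.
have [psi1J psi2J] := conjc_psi (W j k) (Z j k).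
rewrite -conjc_delta2 /conjg -psi1J -psi2J.
move: (D j k) (delta2 _ _ _ _ _) (psi1 _ _) (psi2 _ _) (v j k) => q l p1 p2 x.
move/(congr1 (@conjc R)).
by rewrite conjc0 !conjcE conjcK.
Qed.

Let conjDE j k : conjg D j k = conjg V j k / tau%:C.
Proof. by rewrite /conjg /D /V !conjcE. Qed.

(** The difference between the scheme tested against the conjugate of S = W + Z
    and its conjugate.  The gradient products drop out because S = 2 H. *)
Lemma mass_cell j k : (j < J)%N -> (k < K)%N ->
  green_density dx dy (conjg H) S j k - green_density dx dy H (conjg S) j k
  = 2 * 'i%C / tau%:C * (`|W j k| ^+ 2 - `|Z j k| ^+ 2).
Proof.
move=> jJ kK.
have xsym : delta_x dx (conjg H) j k * delta_x dx S j k
          = delta_x dx H j k * delta_x dx (conjg S) j k.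
  by rewrite /delta_x /conjg /H /S !conjcE; ring.
have ysym : delta_y dy (conjg H) j k * delta_y dy S j k
          = delta_y dy H j k * delta_y dy (conjg S) j k.
  by rewrite /delta_y /conjg /H /S !conjcE; ring.
have := tested_scheme (inX_conjg SX) jJ kK.
have := tested_scheme_conj SX jJ kK.
have := psi1_mass (W j k) (Z j k).
have := psi2_mass (W j k) (Z j k).
have := polarize (W j k) (Z j k).
rewrite /green_density xsym ysym conjDE /D.
rewrite -/(conjg S j k) -/(S j k) -/(V j k) -/(conjg V j k).
move: (`|W j k| ^+ 2 - _) => m.
move: (delta_x dx H j k * _) (delta_y dy H j k * _) => px py.
move: (delta2 _ _ _ _ _) (delta2 _ _ _ _ _) => L L'.
move: (psi1 _ _) (psi2 _ _) (psi1 _ _) (psi2 _ _) => p1' p2' p1 p2.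
move: (S j k) (conjg S j k) (V j k) (conjg V j k) tau%:C^-1 => s s' v v' t.
move=> pol e2 e1 E' E.
(* The tested scheme and its conjugate, corrected by the terms that the
   identities for the nonlinearity and the time difference evaluate. *)
transitivity (
  (- 'i%C * (v' * t) + L' + lambda%:C * p1' - nu%:C * p2') * s
  - ('i%C * (v * t) + L + lambda%:C * p1 - nu%:C * p2) * s'
  + 'i%C * t * (s * v' + s' * v)
  + lambda%:C * (p1 * s' - p1' * s) - nu%:C * (p2 * s' - p2' * s)).
  by ring.
by rewrite E' E pol e1 e2; ring.
Qed.

(** The sum of the scheme tested against the conjugate of V = W - Z and of its
    conjugate.  The gradient products polarize because H and V are half the sum
    and the difference of W and Z. *)
Lemma energy_cell j k : (j < J)%N -> (k < K)%N ->
  green_density dx dy H (conjg V) j k + green_density dx dy (conjg H) V j k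
  = (`|delta_x dx W j k| ^+ 2 + `|delta_y dy W j k| ^+ 2
     + (- (lambda%:C / 2) * `|W j k| ^+ 4 + nu%:C / 3 * `|W j k| ^+ 6))
  - (`|delta_x dx Z j k| ^+ 2 + `|delta_y dy Z j k| ^+ 2
     + (- (lambda%:C / 2) * `|Z j k| ^+ 4 + nu%:C / 3 * `|Z j k| ^+ 6)).
Proof.
move=> jJ kK.
have : delta_x dx H j k * delta_x dx (conjg V) j k
       + delta_x dx (conjg H) j k * delta_x dx V j k
       = `|delta_x dx W j k| ^+ 2 - `|delta_x dx Z j k| ^+ 2.
  rewrite !sqr_normc /delta_x /conjg /H /V !conjcE.
  by move: (dx%:C^-1) => r; field.
have : delta_y dy H j k * delta_y dy (conjg V) j k
       + delta_y dy (conjg H) j k * delta_y dy V j k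
       = `|delta_y dy W j k| ^+ 2 - `|delta_y dy Z j k| ^+ 2.
  rewrite !sqr_normc /delta_y /conjg /H /V !conjcE.
  by move: (dy%:C^-1) => r; field.
have := tested_scheme (inX_conjg VX) jJ kK.
have := tested_scheme_conj VX jJ kK.
have := psi1_energy (W j k) (Z j k).
have := psi2_energy (W j k) (Z j k).
rewrite /green_density conjDE /D -/(V j k) -/(conjg V j k).
move: (`|W j k|) (`|Z j k|) => w z.
move: (`|delta_x _ _ _ _| ^+ 2) (`|delta_x _ _ _ _| ^+ 2) => xZ xW.
move: (`|delta_y _ _ _ _| ^+ 2) (`|delta_y _ _ _ _| ^+ 2) => yZ yW.
move: (delta_x dx H j k * _) (delta_y dy H j k * _) => px py.
move: (delta_x dx (conjg H) j k * _) (delta_y dy (conjg H) j k * _) => px' py'.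
move: (delta2 _ _ _ _ _) (delta2 _ _ _ _ _) => L L'.
move: (psi1 _ _) (psi2 _ _) (psi1 _ _) (psi2 _ _) => p1' p2' p1 p2.
move: (V j k) (conjg V j k) tau%:C^-1 => v v' t.
move=> e2 e1 E' E ypol xpol.
(* The time differences of the two tested identities cancel. *)
transitivity (
  ('i%C * (v * t) + L + lambda%:C * p1 - nu%:C * p2) * v'
  + (- 'i%C * (v' * t) + L' + lambda%:C * p1' - nu%:C * p2') * v
  + (px + px') + (py + py')
  - lambda%:C * (p1 * v' + p1' * v) + nu%:C * (p2 * v' + p2' * v)).
  by ring.
by rewrite E' E e1 e2 xpol ypol; ring.
Qed.

Lemma mass_step : mass J K dx dy W = mass J K dx dy Z.
Proof.
apply: (@complexI R); rewrite /mass !normhXC; congr (_ * _).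
apply: subr0_eq; rewrite -gsumB.
have c0 : 2 * 'i%C / tau%:C != 0 :> R[i].
  rewrite !mulf_neq0 ?invr_eq0 ?fmorph_eq0 ?pnatr_eq0 //.
  by rewrite eq_complex /= oner_eq0 andbF.
apply: (mulfI c0); rewrite mulr0 -gsumZ -(eq_gsum mass_cell) gsumB.
by rewrite !gsum_green ?subrr //; exact: inX_conjg.
Qed.

Lemma energy_step :
  energy lambda nu J K dx dy W = energy lambda nu J K dx dy Z.
Proof.
apply: (@complexI R); rewrite !energyC; congr (_ * _).
apply: subr0_eq; rewrite -gsumB -(eq_gsum energy_cell) gsumD.
by rewrite !gsum_green ?addr0 //; exact: inX_conjg.
Qed.

End OneStep.

Theorem mainTheorem5 (R : realType) (lambda nu eps T : R)
  (nu_gt0 : 0 < nu) (eps_ge0 : 0 <= eps) (T_gt0 : 0 < T)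
  (a b c d : R) (ltab : a < b) (ltcd : c < d)
  (u0 : R * R -> R[i])
  (u0_boundary : forall z, boundary (rectangle a b c d) z -> u0 z = 0)
  (J K : nat) (J_gt0 : (0 < J)%N) (K_gt0 : (0 < K)%N)
  (h : R) (dx_h : step a b J = h) (dy_h : step c d K = h)
  (N : nat) (tau : R) (N_tau : N%:R * tau = T)
  (U : nat -> gridfun R)
  (eps0 : eps = 0)
  (U_sol : CNFD_solution lambda nu eps a b c d J K N tau u0 U) :
  forall n, (n < N)%N ->
    mass J K (step a b J) (step c d K) (U n.+1)
      = mass J K (step a b J) (step c d K) (U n) /\
    energy lambda nu J K (step a b J) (step c d K) (U n.+1)
      = energy lambda nu J K (step a b J) (step c d K) (U n).
Proof.
move=> n nN; case: U_sol => U0 UX scheme.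
have tau0 : tau != 0.
  by apply: contraTneq T_gt0 => tau0; rewrite -N_tau tau0 mulr0 ltxx.
have UnX : inX J K (U n).
  case: n nN => [_ | n nN]; first exact: (inX_sample ltab ltcd _ _ u0_boundary).
  exact: UX (ltnW nN).
have eqn j k : inT J K j k -> 'i%C * delta_t tau U n j k
    + delta2 (step a b J) (step c d K) (halfstep U n) j k
    + lambda%:C * psi1 (U n.+1 j k) (U n j k)
    - nu%:C * psi2 (U n.+1 j k) (U n j k) = 0.
  by move=> /(scheme n nN); rewrite eps0 mulr0 mul0r addr0.
split; first exact: (mass_step UnX (UX n nN) tau0 eqn).
exact: (energy_step UnX (UX n nN) eqn).
Qed.
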